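(* Let $\Gamma$ be a connected ve-srg, let $G\le \mathrm{Aut}(\Gamma)$ be transitive on the vertices and on the edges of $\Gamma$, and let $1\neq N\triangleleft G$ be intransitive on $V(\Gamma)$. Let $b$ be the number of vertices in each $N$-orbit. If the quotient graph $\Gamma_N$ is isomorphic to $K_3$, then either $\Gamma\cong K_{3[b]}$, or $b=3$ and $\Gamma\cong K_{3[3]}-3K_3$.
   Context: A strongly regular graph with parameters $(n,k,\lambda,\mu)$ is a (finite, simple) regular graph with $n$ vertices and valency $k$, such that each pair of adjacent vertices lies in exactly $\lambda$ triangles and each pair of distinct non-adjacent vertices (if such exist) is joined by exactly $\mu$ paths of length 2. The complete graph $K_n$ is regarded as strongly regular with parameters $(n,n-1,n-2,0)$. A ve-srg is a strongly regular graph whose automorphism group is transitive on vertices and transitive on (undirected) edges. Quotient graph: if $G\le\mathrm{Aut}(\Gamma)$ is vertex-transitive and $1\neq N\triangleleft G$ is intransitive on $V(\Gamma)$, then $\Gamma_N$ is the graph whose vertices are the orbits ${}^Nx=\{h(x): h\in N\}$ of $N$ on $V(\Gamma)$, two distinct orbits ${}^Nx,{}^Ny$ being adjacent if and only if some $x'\in{}^Nx$ and some $y'\in{}^Ny$ are adjacent in $\Gamma$. $K_{c[b]}$ denotes the complete $c$-partite graph with $b$ vertices in each part. $K_{b[b]}-bK_b$ denotes the complete $b$-partite graph with $b$ vertices in each part, with the edges of $b$ vertex-disjoint copies of $K_b$ deleted. *)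

(* Defs.v *)
From mathcomp Require Import all_boot all_fingroup.

Set Implicit Arguments.
Unset Strict Implicit.
Unset Printing Implicit Defensive.

Record sgraph := SGraph {
  vertex :> finType;
  adj : rel vertex;
  adj_sym : symmetric adj;
  adj_irr : irreflexive adj }.

Definition edges (Γ : sgraph) : {set {set Γ}} :=
  [set [set p.1; p.2] | p : Γ * Γ & adj p.1 p.2].

Definition connected (Γ : sgraph) : Prop := forall x y : Γ, connect (@adj Γ) x y.

Definition giso (Γ Δ : sgraph) : Prop :=
  exists2 f : Γ -> Δ, bijective f & forall x y, adj (f x) (f y) = adj x y.

Definition gaut (Γ : sgraph) : {set {perm Γ}} :=
  [set s : {perm Γ} | [forall x, forall y, adj (s x) (s y) == adj x y]].

Lemma gaut_group_set (Γ : sgraph) : group_set (gaut Γ).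
Proof.
apply/group_setP; split=> [|s t].
  by rewrite inE; apply/'forall_'forall_eqP => x y; rewrite !perm1.
rewrite !inE => /'forall_'forall_eqP Hs /'forall_'forall_eqP Ht.
by apply/'forall_'forall_eqP => x y; rewrite !permM Ht Hs.
Qed.

Canonical gaut_group (Γ : sgraph) : {group {perm Γ}} := Group (gaut_group_set Γ).

(* [transitive A, on S | to] requires S to be nonempty; a connected graph has
   no edges only if it has at most one vertex. *)
Definition vertex_transitive (Γ : sgraph) (A : {set {perm Γ}}) : Prop :=
  [transitive A, on [set: Γ] | 'P].

Definition edge_transitive (Γ : sgraph) (A : {set {perm Γ}}) : Prop :=
  [transitive A, on edges Γ | 'P^*].

(* The common neighbours of x and y are the middle vertices of the paths of
   length 2 from x to y and, when x and y are adjacent, the third vertices of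
   the triangles through the edge xy. *)
Definition common_nbrs (Γ : sgraph) (x y : Γ) : {set Γ} :=
  [set z | adj x z && adj z y].

(* For a complete graph the condition on mu is vacuous, and the last clause
   fixes the convention mu = 0. *)
Definition srg_params (Γ : sgraph) (n k lambda mu : nat) : Prop :=
  [/\ #|Γ| = n,
      forall x : Γ, #|[set y | adj x y]| = k,
      forall x y : Γ, adj x y -> #|common_nbrs x y| = lambda,
      forall x y : Γ, x != y -> ~~ adj x y -> #|common_nbrs x y| = mu
    & (forall x y : Γ, x != y -> adj x y) -> mu = 0].

Definition strongly_regular (Γ : sgraph) : Prop :=
  exists n k lambda mu, srg_params Γ n k lambda mu.

Definition ve_srg (Γ : sgraph) : Prop :=
  [/\ strongly_regular Γ, vertex_transitive (gaut Γ)
    & edge_transitive (gaut Γ)].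

Section Quotient.

Variables (Γ : sgraph) (N : {set {perm Γ}}).

Definition norbits : {set {set Γ}} := [set orbit 'P N x | x : Γ].

Definition quot_vertex : finType := {A : {set Γ} | A \in norbits}.

Definition quot_adj : rel quot_vertex := fun A B =>
  (A != B) && [exists x in val A, exists y in val B, adj x y].

Lemma quot_adj_sym : symmetric quot_adj.
Proof.
move=> A B; rewrite /quot_adj eq_sym; congr andb.
by apply/exists_inP/exists_inP => -[x Hx /exists_inP[y Hy Hxy]];
   exists y => //; apply/exists_inP; exists x; rewrite // adj_sym.
Qed.

Lemma quot_adj_irr : irreflexive quot_adj.
Proof. by move=> A; rewrite /quot_adj eqxx. Qed.

Definition quotient_graph : sgraph := SGraph quot_adj_sym quot_adj_irr.

End Quotient.

Lemma neq_sym (T : eqType) : symmetric (fun x y : T => x != y).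
Proof. by move=> x y; rewrite eq_sym. Qed.

Lemma neq_irr (T : eqType) : irreflexive (fun x y : T => x != y).
Proof. by move=> x; rewrite eqxx. Qed.

Definition complete_graph (n : nat) : sgraph :=
  SGraph (@neq_sym 'I_n) (@neq_irr 'I_n).

(* The parts of K_{c[b]} are the fibres of the first projection. *)
Definition multipartite_adj (c b : nat) : rel ('I_c * 'I_b) :=
  fun u v => u.1 != v.1.

Lemma multipartite_sym c b : symmetric (@multipartite_adj c b).
Proof. by move=> u v; rewrite /multipartite_adj eq_sym. Qed.

Lemma multipartite_irr c b : irreflexive (@multipartite_adj c b).
Proof. by move=> u; rewrite /multipartite_adj eqxx. Qed.

Definition complete_multipartite (c b : nat) : sgraph :=
  SGraph (@multipartite_sym c b) (@multipartite_irr c b).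

(* K_{b[b]} - bK_b. A copy of K_b in K_{b[b]} meets every part exactly once, so
   b disjoint copies partition the vertices; after relabelling inside each part
   they are the fibres of the second projection, whose edges are deleted. *)
Definition multipartite_minus_adj (b : nat) : rel ('I_b * 'I_b) :=
  fun u v => multipartite_adj u v && ~~ (u.2 == v.2).

Lemma multipartite_minus_sym b : symmetric (@multipartite_minus_adj b).
Proof.
by move=> u v; rewrite /multipartite_minus_adj multipartite_sym (eq_sym u.2).
Qed.

Lemma multipartite_minus_irr b : irreflexive (@multipartite_minus_adj b).
Proof. by move=> u; rewrite /multipartite_minus_adj eqxx andbF. Qed.

Definition complete_multipartite_minus (b : nat) : sgraph :=
  SGraph (@multipartite_minus_sym b) (@multipartite_minus_irr b).

(* Main.v *)
Require Import Defs.
From mathcomp Require Import all_boot all_fingroup.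
From mathcomp Require Import zify.

Set Implicit Arguments.
Unset Strict Implicit.
Unset Printing Implicit Defensive.

(** The three [N]-orbits colour the vertices with three colours.  Some edge
    joins different orbits, [N] is normal and [G] is edge-transitive, so no edge
    lies inside an orbit ([edges_cross_orbits]).  As [N] is transitive on each
    orbit, the number [D i j] of neighbours in orbit [j] of a vertex of orbit
    [i] is well defined; counting edges between orbits of equal size gives
    [D i j = D j i], and regularity of the graph then forces all these numbers
    to be one number [d] ([orbit_tripartition]).  The
    classification is then that of the connected strongly regular graphs with a
    proper 3-colouring into classes of size [b] such that every vertex has [d]
    neighbours in each of the two other classes ([connected_tripartite_srg]).

    If [d = b] the graph is complete tripartite.  Otherwise count the paths of
    length two that leave a vertex [x] and end in the class of [x], or in
    another class:
      [2d + (b - 1) mu = 2d^2] and [lambda d + (b - d) mu = d^2].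
    These imply that [d] divides [mu] (in spectral terms, [-d] is an eigenvalue
    because the tripartition is equitable, so the other restricted eigenvalue
    [2 - mu / d] is an integer), and the only possibilities are [mu = 0], which
    connectedness excludes, and [mu = d], [lambda = 1], [b = 2d - 1]
    ([feasible_params]).

    In the last case the triangles are the lines of a generalized quadrangle
    with three points on each line and [d] lines on each point, partitioned
    into three ovoids.  For an edge [xy], every vertex of the third class is
    adjacent to [x] or [y] ([edge_dominates_third_part]).  Hence two neighbours
    of [x] in the same class share all [d - 1] non-neighbours of [x] in the
    third class, which leaves [x] as their only common neighbour in its own
    class ([common_nbrs_back]).  Counting paths of length two once more gives
    [d^2 <= d + (b - 1)], so [d <= 2] ([valency_le2]).  With [d = 2] and
    [b = 3], non-adjacency between different classes is a perfect matching for
    each pair of classes, and the matchings compose, so the graph is [K_{3[3]}]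
    with three disjoint triangles removed ([minus_iso]). *)

(** * Counting and colours *)

Lemma sum_card_rel (T : finType) (A B : {set T}) (e : rel T) :
  \sum_(x in A) #|[set y in B | e x y]| = \sum_(y in B) #|[set x in A | e x y]|.
Proof.
have card1 (S : {set T}) (P : pred T) :
    #|[set y in S | P y]| = \sum_(y in S | P y) 1.
  by rewrite -sum1_card; apply: eq_bigl => y; rewrite inE.
under eq_bigr do rewrite card1.
rewrite (exchange_big_dep (mem B)) /=; last by move=> x y _ /andP[].
apply: eq_bigr => y yB; rewrite card1.
by apply: eq_bigl => x; rewrite yB.
Qed.

Lemma injection_into_ord (T : finType) (S : {set T}) b :
  #|S| = b -> 0 < b -> exists g : T -> 'I_b, {in S &, injective g}.
Proof.
move=> <- /card_gt0P[x xS]; exists (enum_rank_in xS) => y z yS zS.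
exact: enum_rank_in_inj.
Qed.

Lemma third_colour (i j : 'I_3) : exists l : 'I_3, (l != i) && (l != j).
Proof.
have [l] : exists l, l \in ~: [set i; j].
  by apply/card_gt0P; have := cardsC [set i; j]; rewrite card_ord cards2; lia.
by rewrite !inE negb_or; exists l.
Qed.

Lemma third_colour_eq (i j l m : 'I_3) :
  i != j -> l != i -> l != j -> m != i -> m != j -> l = m.
Proof.
rewrite -!val_eqE => /= *; apply: val_inj => /=.
by move: (ltn_ord i) (ltn_ord j) (ltn_ord l) (ltn_ord m); lia.
Qed.

(** * Regular tripartitions of strongly regular graphs *)

Section Tripartition.

Variables (Γ : sgraph) (c : Γ -> 'I_3).

Definition part (i : 'I_3) : {set Γ} := [set x | c x == i].

Definition nbrs_in (x : Γ) (i : 'I_3) : {set Γ} := [set y in part i | adj x y].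

Record regular_tripartition (b d : nat) : Prop := RegularTripartition {
  part_card : forall i, #|part i| = b;
  part_indep : forall x y, c x = c y -> adj x y = false;
  part_valency : forall x i, i != c x -> #|nbrs_in x i| = d }.

Lemma sum_edges_between i j :
  \sum_(x in part i) #|nbrs_in x j| = \sum_(y in part j) #|nbrs_in y i|.
Proof.
rewrite [LHS](sum_card_rel (part i) (part j) (@adj Γ)).
by apply: eq_bigr => y _; apply: eq_card => x; rewrite !inE adj_sym.
Qed.

(** When [S] consists of neighbours of [x], both sides count the paths of length
    two from [x] through [S] to [part i]. *)
Lemma sum_paths (x : Γ) (S : {set Γ}) i :
  \sum_(z in part i) #|[set y in S | adj z y]| = \sum_(y in S) #|nbrs_in y i|.
Proof.
rewrite [LHS](sum_card_rel (part i) S (@adj Γ)).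
by apply: eq_bigr => y _; apply: eq_card => z; rewrite !inE adj_sym.
Qed.

Lemma colouring_bijective b (g : Γ -> 'I_b) :
    (forall i, #|part i| = b) ->
    (forall x y, c x = c y -> g x = g y -> x = y) ->
  bijective (fun x => (c x, g x)).
Proof.
move=> card_part g_inj; apply: inj_card_bij => [x y [] //|]; first exact: g_inj.
rewrite card_prod !card_ord -[X in _ <= X]sum1_card.
rewrite (partition_big c predT) //=.
rewrite (eq_bigr (fun=> b)) => [|i _]; last first.
  by rewrite sum1dep_card -(card_part i).
by rewrite sum_nat_const card_ord.
Qed.

Variables (b d : nat).
Hypothesis (tri : regular_tripartition b d).

Lemma adj_colour_neq (x y : Γ) : adj x y -> c x != c y.
Proof. by move=> xy; apply/eqP => /(part_indep tri); rewrite xy. Qed.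

Lemma tripartition_degree (x : Γ) : #|[set y | adj x y]| = 2 * d.
Proof.
rewrite -sum1_card (partition_big c predT) //= (bigD1 (c x)) //=.
rewrite big1 ?add0n => [|y /andP[]]; last first.
  by rewrite inE => /adj_colour_neq; rewrite eq_sym => /negP.
rewrite (eq_bigr (fun=> d)) => [|i ix].
  by rewrite sum_nat_const cardC1 card_ord.
rewrite -(part_valency tri ix) -sum1_card; apply: eq_bigl => y.
by rewrite !inE andbC.
Qed.

Lemma complete_tripartite_iso :
  0 < b -> d = b -> giso Γ (complete_multipartite 3 b).
Proof.
move=> b_gt0 db.
have [g g_inj] : exists g : 'I_3 -> Γ -> 'I_b,
    forall i, {in part i &, injective (g i)}.
  apply: (fin_all_exists (P := fun i u => {in part i &, injective u})) => i.
  exact: injection_into_ord (part_card tri i) b_gt0.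
exists (fun x => (c x, g (c x) x)) => [|x y].
  apply: (colouring_bijective (part_card tri)) => x y cxy; rewrite cxy.
  by apply: g_inj; rewrite inE ?cxy.
rewrite /= /multipartite_adj /=; case: eqVneq => [/(part_indep tri)-> // | cxy].
have /setP/(_ y) : nbrs_in x (c y) = part (c y).
  apply/eqP; rewrite eqEcard (part_card tri) (part_valency tri) 1?eq_sym // db.
  by rewrite leqnn andbT; apply/subsetP => z; rewrite inE => /andP[].
by rewrite !inE eqxx /= => ->.
Qed.

Variables (n k lambda mu : nat).
Hypothesis (srg : srg_params Γ n k lambda mu).

Let common_adj (x y : Γ) : adj x y -> #|common_nbrs x y| = lambda.
Proof. by case: srg => _ _ + _ _; apply. Qed.

Let common_nonadj (x y : Γ) : x != y -> ~~ adj x y -> #|common_nbrs x y| = mu.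
Proof. by case: srg => _ _ _ + _; apply. Qed.

(** The paths of length two from [x] back to its own part: [2 * d] of them return
    to [x], and every other vertex of the part is the end of [mu] of them. *)
Lemma count_same_part (x : Γ) : 2 * d + b.-1 * mu = 2 * d * d.
Proof.
have := sum_paths x [set y | adj x y] (c x).
rewrite [RHS](eq_bigr (fun=> d)) => [|y]; last first.
  by rewrite inE => /adj_colour_neq; apply: (part_valency tri).
rewrite sum_nat_const tripartition_degree (bigD1 x) ?inE //= => <-.
congr (_ + _).
  rewrite -(tripartition_degree x); apply: eq_card => y.
  by rewrite !inE andbb.
rewrite (eq_bigr (fun=> mu)) => [|z /andP[]].
  rewrite sum_nat_const; congr (_ * _).
  rewrite -(part_card tri (c x)) (cardsD1 x) inE eqxx add1n /=.
  by apply: eq_card => z; rewrite [RHS]unfold_in !inE andbC.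
rewrite inE => /eqP cz zx; rewrite -(@common_nonadj x z) 1?eq_sym //.
  by apply: eq_card => y; rewrite !inE (adj_sym z).
by rewrite (part_indep tri) // cz.
Qed.

Lemma common_nbrs_third (x z : Γ) j :
    c x != c z -> j != c x -> j != c z ->
  common_nbrs x z = [set y in nbrs_in x j | adj z y].
Proof.
move=> cxz jx jz; apply/setP => y; rewrite !inE (adj_sym z).
case xy: (adj x y); case yz: (adj y z); rewrite ?andbF ?andbT //.
apply/esym/eqP; apply: (third_colour_eq cxz) => //.
  by rewrite eq_sym adj_colour_neq.
exact: adj_colour_neq.
Qed.

(** The paths of length two from [x] to a given other part all pass through the
    third part; they end at the [d] neighbours of [x] and the [b - d]
    non-neighbours of [x] there. *)
Lemma count_other_part (x : Γ) : lambda * d + (b - d) * mu = d * d.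
Proof.
have [l /andP[lx _]] := third_colour (c x) (c x).
have [j /andP[jx jl]] := third_colour (c x) l.
have := sum_paths x (nbrs_in x j) l.
rewrite [RHS](eq_bigr (fun=> d)) => [|y]; last first.
  rewrite !inE => /andP[/eqP cy _]; apply: (part_valency tri).
  by rewrite cy eq_sym.
rewrite sum_nat_const (part_valency tri) // => <-.
have third z : z \in part l ->
    [set y in nbrs_in x j | adj z y] = common_nbrs x z.
  rewrite inE => /eqP cz.
  by rewrite -common_nbrs_third // cz // eq_sym.
rewrite (bigID (adj x)) /=; congr (_ + _).
  rewrite (eq_bigr (fun=> lambda)) => [|z /andP[/third-> /common_adj //]].
  rewrite sum_nat_const mulnC -(part_valency tri lx); congr (_ * _).
  by apply: eq_card => z; rewrite [RHS]unfold_in !inE.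
rewrite (eq_bigr (fun=> mu)) => [|z /andP[zl xz]].
  rewrite sum_nat_const -(part_card tri l) -(part_valency tri lx).
  rewrite -[X in (X - _) * _](cardsID [set z | adj x z] (part l)).
  congr (_ * _).
  rewrite (_ : part l :&: [set z | adj x z] = nbrs_in x l).
    by rewrite addKn; apply: eq_card => z; rewrite [RHS]unfold_in !inE andbC.
  by apply/setP => z; rewrite !inE.
rewrite third // common_nonadj //.
by apply: contraNneq lx => ->; rewrite inE in zl; rewrite eq_sym.
Qed.

(** Eliminating [b * mu] from the two counts gives
    [mu + d * (d + lambda) = d * (mu + 2)], hence [mu = m * d]; after division by
    [d] the first count reads [2 + (b - 1) * m = 2 * d], which leaves only
    [m <= 1] because [d <= b - 1]. *)
Lemma feasible_params (x : Γ) : 0 < d < b ->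
  mu = 0 \/ [/\ mu = d, lambda = 1 & b.+1 = 2 * d].
Proof.
move=> /andP[d_gt0 db].
have [e be] : exists e, b = d + e.+1 by exists (b - d).-1; lia.
have := count_same_part x; rewrite (_ : b.-1 = d + e); last by lia.
have := count_other_part x; rewrite (_ : b - d = e.+1); last by lia.
move=> other same.
have /dvdnP[m mu_eq] : d %| mu.
  rewrite -(dvdn_addl mu (dvdn_mulr (d + lambda) (dvdnn d))).
  suff -> : mu + d * (d + lambda) = d * (mu + 2) by rewrite dvdn_mulr.
  by lia.
have {}same : 2 + (d + e) * m = 2 * d.
  by apply/eqP; rewrite -(eqn_pmul2l d_gt0); apply/eqP; lia.
have {}other : lambda + e.+1 * m = d.
  by apply/eqP; rewrite -(eqn_pmul2l d_gt0); apply/eqP; lia.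
case: m mu_eq same other => [|[|m]] mu_eq same other; first by left.
  by right; split; lia.
by nia.
Qed.

(** With [mu = 0], adjacency together with equality is transitive, so a connected
    graph would be complete; but [x] has a non-neighbour in another part. *)
Lemma connected_mu_gt0 : connected Γ -> d < b -> mu != 0.
Proof.
move=> conn db; apply/eqP => mu0.
have trans x : closed (@adj Γ) [pred y | (y == x) || adj x y].
  apply: intro_closed => [|y z yz]; first exact: sym_connect_sym (@adj_sym Γ).
  rewrite !inE => /predU1P[<-|xy]; first by rewrite yz orbT.
  apply: contraT; rewrite negb_or => /andP[zx xz].
  have := common_nonadj _ xz; rewrite eq_sym zx mu0 => /(_ isT)/eqP.
  by rewrite cards_eq0 => /eqP/setP/(_ y); rewrite !inE xy yz.
have /card_gt0P[x xi] : 0 < #|part ord0| by rewrite (part_card tri); lia.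
have [i /andP[ix _]] := third_colour (c x) (c x).
have /subsetPn[y yi] : ~~ (part i \subset nbrs_in x i).
  apply: contraL db => /subset_leq_card.
  by rewrite (part_card tri) (part_valency tri) // -leqNgt.
have := closed_connect (trans x) (conn x y); rewrite !inE eqxx /= => /esym.
case/predU1P=> [yx|->]; last by move: yi; rewrite inE andbT => ->.
by move: yi ix; rewrite inE yx eq_sym => ->.
Qed.

Hypotheses (lambda1 : lambda = 1) (mu_d : mu = d) (b_d : b.+1 = 2 * d).

(** The common neighbours of [x] and [y] all lie in the third part, so the two
    neighbourhoods there have size [d] and meet in [lambda = 1] vertex; their
    union has [2 * d - 1 = b] vertices and is the whole part. *)
Lemma edge_dominates_third_part (x y z : Γ) :
  adj x y -> c z != c x -> c z != c y -> adj x z || adj y z.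
Proof.
move=> xy zx zy; set l := c z.
have cxy := adj_colour_neq xy.
have cap : nbrs_in x l :&: nbrs_in y l = common_nbrs x y.
  rewrite (common_nbrs_third cxy zx zy); apply/setP => w; rewrite !inE.
  by case: eqP.
have := cardsUI (nbrs_in x l) (nbrs_in y l).
rewrite cap common_adj // !(part_valency tri) // => cardU.
have /setP/(_ z) : nbrs_in x l :|: nbrs_in y l = part l.
  apply/eqP; rewrite eqEcard (part_card tri); apply/andP; split; last by lia.
  by apply/subsetP => w; rewrite !inE => /orP[] /andP[].
by rewrite !inE eqxx.
Qed.

(** By [edge_dominates_third_part], [y1] and [y2] are both adjacent to the
    [b - d = d - 1] vertices of the third part that are not adjacent to [x].
    Together with [x] these are already [mu = d] common neighbours. *)
Lemma common_nbrs_back (x y1 y2 a : Γ) :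
    adj x y1 -> adj x y2 -> c y1 = c y2 -> y1 != y2 ->
    c a = c x -> adj a y1 -> adj a y2 ->
  a = x.
Proof.
move=> xy1 xy2 cy y12 ca ay1 ay2; apply: contraTeq isT => ax.
have [l /andP[lx ly]] := third_colour (c x) (c y1).
have far z : z \in part l :\: nbrs_in x l -> (c z = l) /\ ~~ adj x z.
  by rewrite !inE; case: eqP => //= ->; rewrite andbT.
have far_adj y z : adj x y -> c y = c y1 -> z \in part l :\: nbrs_in x l ->
    adj y z.
  move=> xy cy1 /far[cz xz].
  have := @edge_dominates_third_part x y z xy; rewrite cz cy1 (negPf xz).
  exact.
(* A common neighbour [a] of [y1] and [y2] other than [x] would be one too many. *)
have y1y2 : ~~ adj y1 y2 by rewrite (part_indep tri).
have sub : a |: (x |: (part l :\: nbrs_in x l)) \subset common_nbrs y1 y2.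
  apply/subsetP => z; rewrite !in_setU1.
  case/predU1P=> [->|]; first by rewrite !inE adj_sym ay1.
  case/predU1P=> [->|zl]; first by rewrite !inE adj_sym xy1.
  by rewrite inE (far_adj y1) // adj_sym (far_adj y2).
have := subset_leq_card sub; rewrite (common_nonadj y12 y1y2) !cardsU1.
have not_far z : c z = c x -> z \notin part l :\: nbrs_in x l.
  by move=> cz; apply: contra lx => /far[<- _]; rewrite cz.
rewrite in_setU1 negb_or ax !not_far //= cardsD.
rewrite (setIidPr _); last by apply/subsetP => z; rewrite inE => /andP[].
by rewrite (part_card tri) (part_valency tri) //; lia.
Qed.

(** Among the [d * d] paths of length two from [x] through one part back to the
    part of [x], [d] return to [x], and by [common_nbrs_back] each of the
    [b - 1 = 2 * d - 2] other vertices is the end of at most one. *)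
Lemma valency_le2 (x : Γ) : d <= 2.
Proof.
have [j /andP[jx _]] := third_colour (c x) (c x).
have := sum_paths x (nbrs_in x j) (c x).
rewrite [RHS](eq_bigr (fun=> d)) => [|y]; last first.
  by rewrite !inE => /andP[/eqP cy _]; rewrite (part_valency tri) // cy eq_sym.
rewrite sum_nat_const (part_valency tri) // (bigD1 x) ?inE //= => E.
have : d * d <= d + b.-1.
  rewrite -E; apply: leq_add.
    rewrite -(part_valency tri jx); apply: subset_leq_card.
    by apply/subsetP => y; rewrite inE => /andP[].
  apply: (@leq_trans (\sum_(z in part (c x) | z != x) 1)).
    apply: leq_sum => z /andP[]; rewrite inE => /eqP cz zx.
    apply/card_le1_eqP => y1 y2; rewrite !inE.
    move=> /andP[/andP[/eqP c1 xy1] zy1] /andP[/andP[/eqP c2 xy2] zy2].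
    apply: contraNeq zx => y12.
    by apply/eqP/(common_nbrs_back xy1 xy2); rewrite ?c1 ?c2 // eq_sym.
  rewrite sum1_card -(part_card tri (c x)) (cardsD1 x (part _)) inE eqxx /=.
  by apply/eq_leq/eq_card => z; rewrite [LHS]unfold_in !inE andbC.
by nia.
Qed.

(** Every vertex has [b - d = 1] non-neighbour in each other part.  The relation
    [E] of being equal or non-adjacent in different parts is transitive, since
    [edge_dominates_third_part] forbids an edge whose ends are both non-adjacent
    to a vertex of the third part.  The class of [x] is labelled by its
    representative [p x] of colour [0]; colour and label are the coordinates. *)
Lemma minus_iso : d = 2 -> b = 3 /\ giso Γ (complete_multipartite_minus 3).
Proof.
move=> d2; have b3 : b = 3 by lia.
split=> //.
pose E (x y : Γ) := (x == y) || ((c x != c y) && ~~ adj x y).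
have E_sym x y : E x y = E y x.
  by rewrite /E eq_sym (eq_sym (c x)) adj_sym.
have part_far x i : i != c x -> #|part i :\: nbrs_in x i| = 1.
  move=> ix; rewrite cardsD (setIidPr _).
    by rewrite (part_card tri) (part_valency tri) // b3 d2.
  by apply/subsetP => z; rewrite inE => /andP[].
have E_uniq x y z : E x y -> E x z -> c y = c z -> y = z.
  rewrite /E; case/predU1P=> [<-|/andP[xy nxy]].
    by case/predU1P=> [//|/andP[xz _ /eqP]]; rewrite (negPf xz).
  case/predU1P=> [<- /esym/eqP|/andP[xz nxz] cyz]; first by rewrite (negPf xy).
  have /eqP/cards1P[w /setP far] : #|part (c y) :\: nbrs_in x (c y)| = 1.
    by apply: part_far; rewrite eq_sym.
  have := far y; have := far z; rewrite !inE cyz eqxx nxy nxz.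
  by move=> /esym/eqP-> /esym/eqP->.
have E_trans x y z : E x y -> E y z -> E x z.
  move=> Exy Eyz; have [cxz|cxz] := eqVneq (c x) (c z).
    by rewrite (@E_uniq y x z) ?/E ?eqxx // -/(E _ _) E_sym.
  case/predU1P: (Exy) => [->//|/andP[xy nxy]].
  case/predU1P: (Eyz) => [<-//|/andP[yz nyz]].
  rewrite /E cxz; apply/orP; right; apply/negP => xz.
  have := edge_dominates_third_part xz; move/(_ y); rewrite (negPf nxy).
  by rewrite eq_sym xy yz adj_sym (negPf nyz); move/(_ isT isT).
have [p p0] : exists p : Γ -> Γ, forall x, (p x \in part ord0) && E x (p x).
  apply: (fin_all_exists (P := fun x u => (u \in part ord0) && E x u)) => x.
  have [x0|x0] := eqVneq (c x) ord0; first by exists x; rewrite /E inE x0 !eqxx.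
  have /card_gt0P[a] : 0 < #|part ord0 :\: nbrs_in x ord0|.
    by rewrite part_far // eq_sym.
  rewrite !inE negb_and => /andP[]; case: eqP => //= a0 xa _.
  by exists a; rewrite inE /E a0 eqxx x0 xa orbT.
have E_p x y : E x y = (p x == p y).
  have [/andP[px Ex] /andP[py Ey]] := (p0 x, p0 y).
  apply/idP/eqP => [Exy | pxy].
    apply: (@E_uniq x) => //; first exact: E_trans Exy Ey.
    by move: px py; rewrite !inE => /eqP-> /eqP->.
  by apply: E_trans Ex _; rewrite pxy E_sym.
have card0 : #|part ord0| = 3 by rewrite (part_card tri).
have [g g_inj] := injection_into_ord card0 isT.
have g_p x y : (g (p x) == g (p y)) = E x y.
  rewrite E_p; apply/eqP/eqP => [|-> //].
  by apply: g_inj; [case/andP: (p0 x) | case/andP: (p0 y)].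
exists (fun x => (c x, g (p x))) => [|x y].
  apply: colouring_bijective => [i|x y cxy /eqP].
    by rewrite (part_card tri).
  by rewrite g_p /E cxy eqxx orbF => /eqP.
rewrite /= /multipartite_minus_adj /multipartite_adj /= g_p /E.
case: eqVneq => [/(part_indep tri)-> // | cxy] /=.
have -> : (x == y) = false by apply: contraNF cxy => /eqP->.
by rewrite negbK.
Qed.

End Tripartition.

Lemma connected_tripartite_srg (Γ : sgraph) (c : Γ -> 'I_3) (b d : nat) :
    connected Γ -> strongly_regular Γ -> regular_tripartition c b d ->
    0 < d <= b ->
  giso Γ (complete_multipartite 3 b) \/
  (b = 3 /\ giso Γ (complete_multipartite_minus 3)).
Proof.
move=> conn [n [k [lambda [mu srg]]]] tri /andP[d_gt0 d_le].
have b_gt0 := leq_trans d_gt0 d_le.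
have /card_gt0P[x _] : 0 < #|part c ord0| by rewrite (part_card tri).
move: d_le; rewrite leq_eqVlt => /predU1P[db|db].
  by left; apply: complete_tripartite_iso tri _ _.
have d_range : 0 < d < b by rewrite d_gt0.
right; have [mu0 | [mud l1 bd]] := feasible_params tri srg x d_range.
  by have := connected_mu_gt0 tri srg conn db; rewrite mu0.
have d2 := valency_le2 tri srg l1 mud bd x.
by apply: (minus_iso tri srg) => //; lia.
Qed.

(** * The colouring by orbits *)

Lemma gautP (Γ : sgraph) (s : {perm Γ}) (x y : Γ) :
  s \in gaut Γ -> adj (s x) (s y) = adj x y.
Proof. by rewrite inE => /'forall_'forall_eqP. Qed.

(** The representatives of two adjacent orbits supply the edge whose ends have
    different colours. *)
Lemma quotient_colouring (Γ : sgraph) (N : {group {perm Γ}}) m :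
    1 < m -> giso (quotient_graph N) (complete_graph m) ->
  exists c : Γ -> 'I_m,
    [/\ forall x y, (c x == c y) = (x \in orbit 'P N y),
        forall i, exists x, c x = i
      & exists x y : Γ, adj x y && (c x != c y)].
Proof.
move=> m_gt1 [f [g fK gK] f_adj].
have orbit_norbits (x : Γ) : orbit 'P N x \in norbits N.
  by apply/imsetP; exists x.
pose q (x : Γ) : quotient_graph N := Sub (orbit 'P N x) (orbit_norbits x).
have q_onto (A : quotient_graph N) x : x \in val A -> q x = A.
  case/imsetP: (valP A) => y _ Ay; rewrite Ay => /orbit_eqP xy.
  by apply: val_inj; rewrite Ay -xy.
have fq_eq x y : (f (q x) == f (q y)) = (x \in orbit 'P N y).
  by rewrite (can_eq fK) -val_eqE /= orbit_eq_mem.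
exists (f \o q); split=> // [i|].
  case/imsetP: (valP (g i)) => x _ gi; exists x => /=.
  by rewrite (@q_onto (g i)) ?gK // gi orbit_refl.
pose i := Ordinal (ltnW m_gt1); pose j := Ordinal m_gt1.
have /andP[_ /exists_inP[x xi /exists_inP[y yj xy]]] : adj (g i) (g j).
  by rewrite -f_adj !gK.
by exists x, y; rewrite xy /= (q_onto _ _ xi) (q_onto _ _ yj) !gK.
Qed.

(** Elements of [G] permute the [N]-orbits, and edge-transitivity moves the edge
    [xy], which joins different orbits, to any other edge. *)
Lemma edges_cross_orbits (Γ : sgraph) (G N : {group {perm Γ}}) (x y u v : Γ) :
    edge_transitive G -> (N <| G)%g ->
    adj x y -> y \notin orbit 'P N x -> adj u v ->
  v \notin orbit 'P N u.
Proof.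
move=> Gtrans /andP[_ nNG] xy Nxy uv.
have mem_edges (s t : Γ) : adj s t -> [set s; t] \in edges Γ.
  by move=> st; apply/imsetP; exists (s, t); rewrite ?inE.
have [g gG uv_eq] := atransP2 Gtrans (mem_edges _ _ xy) (mem_edges _ _ uv).
have Nimage h s t : h \in G -> s \in orbit 'P N t -> h s \in orbit 'P N (h t).
  move=> hG /orbitP[m mN <-]; apply/orbitP; exists (m ^ h)%g.
    by rewrite memJ_norm // (subsetP nNG).
  by rewrite /= /aperm conjgE !permM permK.
apply: contra Nxy => Nuv.
have : g y \in orbit 'P N (g x).
  have /setP uvE : [set u; v] = [set g x; g y].
    by rewrite uv_eq /= /setact imsetU1 imset_set1.
  have := uvE (g x); have := uvE (g y); rewrite !inE !eqxx orbT orTb.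
  case/predU1P=> [->|/eqP->]; case/predU1P=> [->|/eqP->] //.
  - exact: orbit_refl.
  - by rewrite orbit_sym.
  - exact: orbit_refl.
move/(Nimage g^-1%g _ _); rewrite groupV !permK; exact.
Qed.

Lemma orbit_nbrs_card (Γ : sgraph) (N : {group {perm Γ}}) (c : Γ -> 'I_3)
    (x y : Γ) i :
    N \subset gaut Γ -> (forall u v, (c u == c v) = (u \in orbit 'P N v)) ->
    c x = c y ->
  #|nbrs_in c x i| = #|nbrs_in c y i|.
Proof.
move=> Naut cE /eqP; rewrite cE => /orbitP[h hN <-] /=; rewrite /aperm.
rewrite -[RHS](card_imset _ (@perm_inj _ h)); apply: eq_card => z.
apply/idP/imsetP => [|[w]]; rewrite !inE.
  have ch w : c (h w) = c w.
    by apply/eqP; rewrite cE; apply: (mem_orbit 'P).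
  case/andP=> cz hyz; exists (h^-1%g z); last by rewrite permKV.
  by rewrite inE -(gautP _ _ (subsetP Naut _ hN)) inE -ch permKV cz.
case/andP=> /eqP cw yw ->; rewrite gautP ?(subsetP Naut) // yw andbT -cw.
by rewrite cE; apply: (mem_orbit 'P).
Qed.

(** Double counting the edges between two parts makes the valencies symmetric.
    The three valencies then have pairwise sums [k], so each of them is half
    of [k]. *)
Lemma orbit_tripartition (Γ : sgraph) (c : Γ -> 'I_3) (b k : nat) :
    0 < b -> (forall i, #|part c i| = b) ->
    (forall x y : Γ, c x = c y -> adj x y = false) ->
    (forall (x y : Γ) i, c x = c y -> #|nbrs_in c x i| = #|nbrs_in c y i|) ->
    (forall x : Γ, #|[set y | adj x y]| = k) ->
  exists d, regular_tripartition c b d.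
Proof.
move=> b_gt0 card_part indep const deg.
have [r rP] : exists r : 'I_3 -> Γ, forall i, c (r i) = i.
  apply: (fin_all_exists (P := fun i u => c u = i)) => i.
  have /card_gt0P[x] : 0 < #|part c i| by rewrite card_part.
  by rewrite inE => /eqP; exists x.
pose D i j := #|nbrs_in c (r i) j|.
have D_sym i j : D i j = D j i.
  have sumD l m : \sum_(x in part c l) #|nbrs_in c x m| = b * D l m.
    rewrite (eq_bigr (fun=> D l m)) ?sum_nat_const ?card_part // => x.
    by rewrite inE => /eqP cx; apply: const; rewrite rP.
  have := sum_edges_between c i j; rewrite !sumD => /eqP.
  by rewrite eqn_pmul2l // => /eqP.
have D_deg i j l : j != i -> l != i -> l != j -> D i j + D i l = k.
  move=> ji li lj; rewrite -(deg (r i)) -cardsUI.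
  rewrite [X in _ + X](_ : _ = 0) ?addn0; last first.
    apply: eq_card0 => y; rewrite !inE; apply/negP.
    by case/andP=> /andP[/eqP-> _] /andP[]; rewrite eq_sym (negPf lj).
  apply: eq_card => y; rewrite !inE -andb_orl; case ry: (adj _ _);
    rewrite ?andbF //.
  rewrite !andbT; case: eqP => //= /eqP yj; apply/eqP.
  apply: (@third_colour_eq i j); rewrite // 1?eq_sym //.
  by apply/eqP => yi; move: ry; rewrite indep // rP.
have D_half i j : j != i -> 2 * D i j = k.
  move=> ji; have [l /andP[li lj]] := third_colour i j.
  have := (D_deg i j l ji li lj); have := D_deg j i l; have := D_deg l i j.
  rewrite !(eq_sym i) !(eq_sym j l) ji li lj (D_sym j i) (D_sym l i) (D_sym l j).
  by move=> /(_ isT isT isT) + /(_ isT isT isT); lia.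
pose i0 : 'I_3 := ord0; have [i1 /andP[i10 _]] := third_colour i0 i0.
exists (D i0 i1); split=> // x j jx; rewrite (@const x (r (c x))) ?rP //.
by have := D_half _ _ jx; have := D_half _ _ i10; rewrite -/(D _ _); lia.
Qed.

Theorem corollary3p7 (Γ : sgraph) (G N : {group {perm Γ}}) (b : nat)
    (Γ_connected : connected Γ)
    (Γ_ve_srg : ve_srg Γ)
    (G_aut : G \subset gaut Γ)
    (G_vtrans : vertex_transitive G)
    (G_etrans : edge_transitive G)
    (N_nontrivial : N :!=: 1%g)
    (N_normal : (N <| G)%g)
    (N_intrans : ~ vertex_transitive N)
    (N_orbits : forall x : Γ, #|orbit 'P N x| = b)
    (quot_K3 : giso (quotient_graph N) (complete_graph 3)) :
  giso Γ (complete_multipartite 3 b) \/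
  (b = 3 /\ giso Γ (complete_multipartite_minus 3)).
Proof.
have [srg _ _] := Γ_ve_srg; have [n [k [lambda [mu [_ deg _ _ _]]]]] := srg.
have Naut := subset_trans (normal_sub N_normal) G_aut.
have [c [cE c_onto [x0 [y0 /andP[xy0 cxy0]]]]] :=
  quotient_colouring (isT : 1 < 3) quot_K3.
have card_part i : #|part c i| = b.
  have [x <-] := c_onto i; rewrite -(N_orbits x).
  by apply: eq_card => y; rewrite inE cE.
have b_gt0 : 0 < b.
  by rewrite -(N_orbits x0); apply/card_gt0P; exists x0; apply: orbit_refl.
have indep (x y : Γ) : c x = c y -> adj x y = false.
  move=> /eqP; rewrite eq_sym cE; apply: contraTF.
  by apply: edges_cross_orbits G_etrans N_normal xy0 _; rewrite -cE eq_sym.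
have [d tri] := orbit_tripartition b_gt0 card_part indep
  (fun x y i => orbit_nbrs_card i Naut cE) deg.
apply: (connected_tripartite_srg Γ_connected srg tri).
have val0 : #|nbrs_in c x0 (c y0)| = d.
  by apply: (part_valency tri); rewrite eq_sym.
apply/andP; split.
  by rewrite -val0; apply/card_gt0P; exists y0; rewrite !inE eqxx.
rewrite -val0 -(card_part (c y0)); apply: subset_leq_card.
by apply/subsetP => y; rewrite inE => /andP[].
Qed.
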